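(* Let $P$ be a one-to-one two-sided matching market, let $\mu^*$ be a stable matching of $P$, let $\mu$ be any matching of $P$ (not necessarily stable), and let $r$ denote the number of pairs that $\mu^*$ and $\mu$ have in common. Then $$|\mu^*|\ \ge\ \frac{|\mu|+r}{2}.$$
   Context: A one-to-one two-sided matching market consists of a finite set $W$ of workers, a finite set $F$ of firms disjoint from $W$ (not necessarily of the same size), a set $E\subseteq W\times F$ of acceptable pairs, namely the pairs in which each party prefers the other to being unmatched, and, for each participant, a strict linear preference order over its acceptable partners (its neighbours in the bipartite graph $(W,F;E)$). Every participant belongs to at least one acceptable pair. A matching is a set of acceptable pairs no two of which share a worker or a firm, i.e. a matching in the bipartite graph $(W,F;E)$ (so matchings are individually rational); $|\mu|$ denotes the number of pairs in $\mu$. A matching $\mu$ is stable if there is no blocking pair, i.e. no acceptable pair $(w,f)$ such that $w$ is unmatched in $\mu$ or prefers $f$ to its partner in $\mu$, and $f$ is unmatched in $\mu$ or prefers $w$ to its partner in $\mu$. *)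

(* Defs.v *)
From mathcomp Require Import all_boot all_order all_algebra.
Set Implicit Arguments.
Unset Strict Implicit.
Unset Printing Implicit Defensive.

(* [r] is only constrained on [D]: its values outside [D] are junk that the
   definitions below never use. *)
Definition strict_linear_on (T : finType) (D : {set T}) (r : rel T) : Prop :=
  [/\ {in D, irreflexive r},
      {in D & &, transitive r}
    & {in D &, forall x y, x != y -> r x y || r y x}].

(* Workers and firms are the elements of two separate finite types, so they
   are disjoint.  [wpref w f g] means that [w] strictly prefers [f] to [g],
   and [fpref f w v] that [f] strictly prefers [w] to [v]. *)
Record market (W F : finType) := Market {
  acceptable : {set W * F};
  wpref : W -> rel F;
  fpref : F -> rel W;
  wpref_linear : forall w,
    strict_linear_on [set f | (w, f) \in acceptable] (wpref w);
  fpref_linear : forall f,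
    strict_linear_on [set w | (w, f) \in acceptable] (fpref f);
  worker_acceptable : forall w, exists f, (w, f) \in acceptable;
  firm_acceptable : forall f, exists w, (w, f) \in acceptable
}.

Section Matchings.
Variables (W F : finType) (P : market W F).
Implicit Types (mu : {set W * F}) (w : W) (f : F).

Definition is_matching mu : Prop :=
  [/\ mu \subset acceptable P,
      forall w f g, (w, f) \in mu -> (w, g) \in mu -> f = g
    & forall w v f, (w, f) \in mu -> (v, f) \in mu -> w = v].

Definition worker_unmatched mu w : Prop := forall f, (w, f) \notin mu.
Definition firm_unmatched mu f : Prop := forall w, (w, f) \notin mu.

Definition blocking mu w f : Prop :=
  [/\ (w, f) \in acceptable P,
      worker_unmatched mu w \/ (exists2 g, (w, g) \in mu & wpref P w f g)
    & firm_unmatched mu f \/ (exists2 v, (v, f) \in mu & fpref P f w v)].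

Definition is_stable mu : Prop :=
  is_matching mu /\ forall w f, ~ blocking mu w f.

End Matchings.

(* Main.v *)
Require Import Defs.
From mathcomp Require Import all_boot all_order all_algebra.
Set Implicit Arguments.
Unset Strict Implicit.
Unset Printing Implicit Defensive.

(** Count the pairs of [mu] whose worker is matched in [mustar] and those whose
    firm is.  Each count is at most the size of [mustar].  Stability forces
    every pair of [mu] to be counted at least once, since otherwise its two
    members would block; every common pair is counted twice. *)

Import GRing.Theory Num.Theory.

(** The counted elements inject under [h] into [h @: B], which is no larger than [B]. With [h] being
    [fst] or [snd] and [A] a matching, this bounds each of the two counts. *)
Lemma card_imset_mem_le (T U : finType) (h : T -> U) (A B : {set T}) :
  {in A &, injective h} -> #|[set p in A | h p \in h @: B]| <= #|B|.
Proof.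
move=> h_inj; apply: leq_trans (leq_imset_card h B).
rewrite -(@card_in_imset _ _ h); last first.
  by move=> p q /setIdP[pA _] /setIdP[qA _]; apply: h_inj.
by apply/subset_leq_card/subsetP=> _ /imsetP[p /setIdP[_ hp] ->].
Qed.

Lemma stable_meets_acceptable (W F : finType) (P : market W F)
    (mu : {set W * F}) (p : W * F) :
  is_stable P mu -> p \in acceptable P ->
  (p.1 \in fst @: mu) || (p.2 \in snd @: mu).
Proof.
case: p => w f [_ noblock] accP; apply/negPn; rewrite negb_or.
(* A worker and a firm both outside the projections of [mu] are unmatched, so each disjunction in
   [blocking] holds on its left side. *)
apply/negP=> /andP[/= wN fN]; apply: (noblock w f); split=> //; left.
  by move=> g; apply: contra wN => wg; apply/imsetP; exists (w, g).
by move=> v; apply: contra fN => vf; apply/imsetP; exists (v, f).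
Qed.

Lemma stable_matching_bound (W F : finType) (P : market W F)
    (mustar mu : {set W * F}) :
  is_stable P mustar -> is_matching P mu ->
  #|mu| + #|mustar :&: mu| <= #|mustar|.*2.
Proof.
move=> stable [/subsetP mu_acc mu_fun mu_inj].
have fst_inj : {in mu &, injective fst}.
  by move=> [w f] [v g] /= wf + wv; rewrite -wv => /(mu_fun _ _ _ wf) ->.
have snd_inj : {in mu &, injective snd}.
  by move=> [w f] [v g] /= wf + fg; rewrite -fg => /(mu_inj _ _ _ wf) ->.
have := leq_add (card_imset_mem_le mustar fst_inj)
                (card_imset_mem_le mustar snd_inj).
(* The two counts sum to union plus intersection of the counted sets: the union contains [mu] by
   stability, the intersection contains the common pairs. *)
rewrite addnn -cardsUI; apply: leq_trans; apply: leq_add;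
  apply/subset_leq_card/subsetP=> p.
- by move=> pmu; rewrite !inE pmu (stable_meets_acceptable stable (mu_acc p pmu)).
- by case/setIP=> pstar pmu; rewrite !inE pmu !imset_f.
Qed.

Local Open Scope ring_scope.

Theorem theorem3 (W F : finType) (P : market W F) (mustar mu : {set W * F})
    (r : nat)
    (mustar_stable : is_stable P mustar)
    (mu_matching : is_matching P mu)
    (r_common : r = #|mustar :&: mu|) :
  (#|mustar|%:R : rat) >= (#|mu|%:R + r%:R) / 2%:R.
Proof.
rewrite ler_pdivrMr ?ltr0n // -natrD -natrM ler_nat muln2 r_common.
exact: stable_matching_bound mustar_stable mu_matching.
Qed.
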